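(* Let $W,T,V$ be pairwise disjoint finite sets, let $\mathcal{N}^g_W=(\mathcal{V}_{WTV},\mathcal{A}_T\oplus\mathcal{A}_V)$ be a generalized multiport, where $\mathcal{A}_T,\mathcal{A}_V$ are affine spaces on $T,V$, and let $\mathcal{V}_T,\mathcal{V}_V$ be the vector space translates of $\mathcal{A}_T,\mathcal{A}_V$ respectively. Then $\mathcal{N}^g_W$ is rigid iff the generalized multiports $\mathcal{N}^{1g}_{WT}=(\mathcal{V}_{WTV},\mathcal{V}_V)$ and $\mathcal{N}^{2g}_W=((\mathcal{V}_{WTV}\leftrightarrow\mathcal{V}_V),\mathcal{V}_T)$ are rigid.
   Context: All vectors are real. A vector on a finite set $X$ is a function $X\to\mathbb{R}$; for disjoint $X,Y$ vectors on $X\uplus Y$ are written $(f_X,f_Y)$ and spaces on $X\uplus Y$ carry the subscript $XY$. $\mathcal{F}_X$ is the space of all vectors on $X$, $\mathbf{0}_X$ the zero space. An affine space on $X$ is a set $x_X+\mathcal{V}_X$ with $\mathcal{V}_X$ a vector space on $X$, its vector space translate. $\mathcal{K}_X\oplus\mathcal{K}_Y=\{(f_X,g_Y):f_X\in\mathcal{K}_X,g_Y\in\mathcal{K}_Y\}$. For a vector space $\mathcal{V}_{SP}$ on $S\uplus P$: $\mathcal{V}_{SP}\circ S=\{f_S:(f_S,f_P)\in\mathcal{V}_{SP}\text{ for some }f_P\}$, $\mathcal{V}_{SP}\times S=\{f_S:(f_S,0_P)\in\mathcal{V}_{SP}\}$, and for a vector space $\mathcal{V}_P$ on $P$ the matched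 composition is $\mathcal{V}_{SP}\leftrightarrow\mathcal{V}_P=\{f_S:(f_S,h_P)\in\mathcal{V}_{SP}\text{ for some }h_P\in\mathcal{V}_P\}$. A generalized multiport $\mathcal{N}^g_A$ is an ordered pair $(\mathcal{V}_{AB},\mathcal{K}_B)$ with $A\cap B=\emptyset$, $\mathcal{V}_{AB}$ a vector space on $A\uplus B$ and $\mathcal{K}_B$ a collection of vectors on $B$. If $\mathcal{K}_B=\mathcal{A}_B$ is an affine space with vector space translate $\mathcal{V}_B$, it is called rigid iff the pair $\{\mathcal{V}_{AB},\mathcal{A}_B\}$ is rigid, i.e. $\mathcal{V}_{AB}\circ B+\mathcal{V}_B=\mathcal{F}_B$ (full sum property) and $(\mathcal{V}_{AB}\times B)\cap\mathcal{V}_B=\mathbf{0}_B$ (zero intersection property). *)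

(* Defs.v *)
(* MathComp(-Analysis); the reals are an arbitrary R : realType. *)
From HB Require Import structures.
From mathcomp Require Import all_boot all_order all_algebra.
From mathcomp Require Import all_classical all_reals.

Set Implicit Arguments.
Unset Strict Implicit.
Unset Printing Implicit Defensive.

Import GRing.Theory.
Local Open Scope classical_set_scope.
Local Open Scope ring_scope.

(* Disjoint finite sets are rendered as finite types, and X ⊎ Y as X + Y.
   The scalars are R^o so that vec R X is a vectType over R. *)
Notation vec R X := {ffun X -> R^o}.

Section Vectors.
Variable R : realType.
Implicit Types X Y A B S P : finType.

(* The vector (f, g) on X ⊎ Y. *)
Definition vpair X Y (f : vec R X) (g : vec R Y) : vec R (X + Y) :=
  [ffun z => match z with inl x => f x | inr y => g y end].

(* For h = inl or inr this is the restriction to a component. *)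
Definition reindex X Y (h : Y -> X) (f : vec R X) : vec R Y :=
  [ffun y => f (h y)].

Fact reindex_is_linear X Y (h : Y -> X) : linear (reindex h).
Proof. by move=> a f g; apply/ffunP => y; rewrite !ffunE. Qed.

HB.instance Definition _ X Y (h : Y -> X) :=
  GRing.isLinear.Build R (vec R X) (vec R Y) _ (reindex h)
    (reindex_is_linear h).

(* V_AB ∘ B; see restrictionP. *)
Definition restriction A B (V : {vspace vec R (A + B)}) : {vspace vec R B} :=
  (linfun (reindex (@inr A B)) @: V)%VS.

(* V_AB × B; see contractionP. *)
Definition contraction A B (V : {vspace vec R (A + B)}) : {vspace vec R B} :=
  (linfun (reindex (@inr A B)) @: (V :&: lker (linfun (reindex (@inl A B)))))%VS.

(* V_SP ↔ V_P; see matched_compositionP. *)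
Definition matched_composition S P
    (VSP : {vspace vec R (S + P)}) (VP : {vspace vec R P}) : {vspace vec R S} :=
  (linfun (reindex (@inl S P)) @:
     (VSP :&: linfun (reindex (@inr S P)) @^-1: VP))%VS.

Lemma vpair_eta X Y (f : vec R (X + Y)) :
  vpair (reindex inl f) (reindex inr f) = f.
Proof. by apply/ffunP => -[x|y]; rewrite !ffunE. Qed.

Lemma reindex_inl_vpair X Y (f : vec R X) (g : vec R Y) :
  reindex inl (vpair f g) = f.
Proof. by apply/ffunP => x; rewrite !ffunE. Qed.

Lemma reindex_inr_vpair X Y (f : vec R X) (g : vec R Y) :
  reindex inr (vpair f g) = g.
Proof. by apply/ffunP => x; rewrite !ffunE. Qed.

Lemma restrictionP A B (V : {vspace vec R (A + B)}) (g : vec R B) :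
  g \in restriction V <-> exists f : vec R A, vpair f g \in V.
Proof.
split=> [/memv_imgP[u uV ->]|[f fgV]].
  by exists (reindex inl u); rewrite lfunE vpair_eta.
by apply/memv_imgP; exists (vpair f g); rewrite // lfunE/= reindex_inr_vpair.
Qed.

Lemma contractionP A B (V : {vspace vec R (A + B)}) (g : vec R B) :
  g \in contraction V <-> vpair 0 g \in V.
Proof.
split=> [/memv_imgP[u]|gV].
  rewrite memv_cap memv_ker lfunE/= => /andP[uV /eqP u0] ->.
  by rewrite lfunE/= -u0 vpair_eta.
apply/memv_imgP; exists (vpair 0 g); last by rewrite lfunE/= reindex_inr_vpair.
by rewrite memv_cap gV memv_ker lfunE/= reindex_inl_vpair eqxx.
Qed.

Lemma matched_compositionP S P (VSP : {vspace vec R (S + P)})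
    (VP : {vspace vec R P}) (f : vec R S) :
  f \in matched_composition VSP VP <->
  exists2 h : vec R P, h \in VP & vpair f h \in VSP.
Proof.
split=> [/memv_imgP[u]|[h hV fhV]].
  rewrite memv_cap -memv_preim lfunE/= => /andP[uV hV] ->.
  by exists (reindex inr u); rewrite // lfunE/= vpair_eta.
apply/memv_imgP; exists (vpair f h); last by rewrite lfunE/= reindex_inl_vpair.
by rewrite memv_cap fhV -memv_preim lfunE/= reindex_inr_vpair.
Qed.

(* K_X ⊕ K_Y *)
Definition direct_sum X Y (K : set (vec R X)) (L : set (vec R Y)) :
    set (vec R (X + Y)) :=
  [set vpair f g | f in K & g in L].

(* A is an affine space on X with vector space translate V. *)
Definition affine_with_translate X (A : set (vec R X)) (V : {vspace vec R X}) :
    Prop :=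
  exists x : vec R X, A = [set x + v | v in [set` V]].

Definition generalized_multiport A B : Type :=
  ({vspace vec R (A + B)} * set (vec R B))%type.

(* The translate of an affine space is unique, so the existential only names
   it; for a collection N.2 that is not affine, rigid N is false. *)
Definition rigid A B (N : generalized_multiport A B) : Prop :=
  exists VB : {vspace vec R B},
    [/\ affine_with_translate N.2 VB,
        (restriction N.1 + VB = fullv)%VS &
        (contraction N.1 :&: VB = 0)%VS].

(* The identification of W ⊎ (T ⊎ V) with (W ⊎ T) ⊎ V; see reassocP. *)
Definition sum_assoc W T V (z : W + (T + V)) : (W + T) + V :=
  match z with
  | inl w => inl (inl w)
  | inr (inl t) => inl (inr t)
  | inr (inr v) => inr v
  end.

Definition reassoc (W T V : finType) (U : {vspace vec R ((W + T) + V)}) :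
    {vspace vec R (W + (T + V))} :=
  (linfun (reindex (@sum_assoc W T V)) @: U)%VS.

Lemma reassocP (W T V : finType) (U : {vspace vec R ((W + T) + V)})
    (f : vec R W) (g : vec R T) (h : vec R V) :
  vpair f (vpair g h) \in reassoc U <-> vpair (vpair f g) h \in U.
Proof.
split=> [/memv_imgP[u uU]|fghU].
  rewrite lfunE/= => /ffunP e; suff -> : vpair (vpair f g) h = u by [].
  apply/ffunP => -[[w|t]|v].
  - by have := e (inl w); rewrite !ffunE.
  - by have := e (inr (inl t)); rewrite !ffunE.
  - by have := e (inr (inr v)); rewrite !ffunE.
apply/memv_imgP; exists (vpair (vpair f g) h); rewrite // lfunE/=.
by apply/ffunP => -[w|[t|v]]; rewrite !ffunE /= ?ffunE.
Qed.

End Vectors.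

(* Main.v *)
Require Import Defs.
From mathcomp Require Import all_boot all_order all_algebra.
From mathcomp Require Import all_classical all_reals.

(** Rigidity only depends on the vector space translate of the affine part
    ([rigidE]), and the translate of a direct sum is the direct sum of the
    translates ([direct_sum_affine]), so everything reduces to statements
    about vectors.

    The zero intersection properties match because, for t in V_T and v in V_V
    with (0, t, v) in V_WTV, t lies in the intersection for the second
    multiport; once t = 0, v lies in the intersection for the first.

    The full sum properties match by solving for the V part and then for the T
    part.  Given (t, v), the first multiport splits v as v1 + v2 with
    (w1, t1, v1) in V_WTV and v2 in V_V; the second then splits the defect
    t - t1 as t3 + t4 with (w3, t3, v3) in V_WTV, v3 in V_V and t4 in V_T.
    Because v3 is in V_V, correcting the T part leaves the V part solvable:
    (t, v) = (t1 + t3, v1 + v3) + (t4, v2 - v3).  Conversely, the decomposition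
    of (0, v) gives that of v, and the decomposition of (t, 0) has opposite V
    components, so both are in V_V and the T components decompose t in the
    second multiport. *)

Set Implicit Arguments.
Unset Strict Implicit.
Unset Printing Implicit Defensive.

Import GRing.Theory.
Local Open Scope classical_set_scope.
Local Open Scope ring_scope.

Section Rigidity.
Variable R : realType.
Implicit Types A B X Y : finType.

Lemma vpairD X Y (f f' : vec R X) (g g' : vec R Y) :
  vpair f g + vpair f' g' = vpair (f + f') (g + g').
Proof. by apply/ffunP => -[x|y]; rewrite !ffunE. Qed.

Lemma vpair_inj X Y (f f' : vec R X) (g g' : vec R Y) :
  vpair f g = vpair f' g' -> f = f' /\ g = g'.
Proof.
move=> e; split.
  by rewrite -(reindex_inl_vpair f g) e reindex_inl_vpair.
by rewrite -(reindex_inr_vpair f g) e reindex_inr_vpair.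
Qed.

Lemma vpair0 X Y : vpair 0 0 = 0 :> vec R (X + Y).
Proof. by apply/ffunP => -[x|y]; rewrite !ffunE. Qed.

Lemma affine_vspace X (U : {vspace vec R X}) : affine_with_translate [set` U] U.
Proof.
exists 0; apply/seteqP; split=> [u uU|_ [u uU <-]] /=; last by rewrite add0r.
by exists u; rewrite ?add0r.
Qed.

(** A vector of the translate is a difference of two points of [K], and
    differences of points of [K] lie in every translate of [K]. *)
Lemma affine_translate_sub X (K : set (vec R X)) (U U' : {vspace vec R X}) :
  affine_with_translate K U -> affine_with_translate K U' -> (U <= U')%VS.
Proof.
move=> [x ->] [y /seteqP[sub _]]; apply/subvP => u uU.
have [u1 u1U' e1] := sub (x + u) (ex_intro2 _ _ u uU erefl).
have [u0 u0U' e0] := sub (x + 0) (ex_intro2 _ _ 0 (mem0v U) erefl).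
suff -> : u = u1 - u0 by apply: rpredB.
apply: (addrI x); rewrite -e1; apply: (addIr u0).
by rewrite -[RHS]addrA subrK -[x in RHS]addr0 -e0 addrAC.
Qed.

Lemma affine_translate_uniq X (K : set (vec R X)) (U U' : {vspace vec R X}) :
  affine_with_translate K U -> affine_with_translate K U' -> U = U'.
Proof.
move=> hU hU'; apply/eqP.
by rewrite eqEsubv !(@affine_translate_sub _ K).
Qed.

Definition vdirect_sum X Y (U : {vspace vec R X}) (U' : {vspace vec R Y}) :
    {vspace vec R (X + Y)} :=
  (linfun (Defs.reindex (@inl X Y)) @^-1: U
     :&: linfun (Defs.reindex (@inr X Y)) @^-1: U')%VS.

Lemma vpair_vdirect_sum X Y (U : {vspace vec R X}) (U' : {vspace vec R Y})
    (f : vec R X) (g : vec R Y) :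
  (vpair f g \in vdirect_sum U U') = (f \in U) && (g \in U').
Proof.
by rewrite memv_cap -!memv_preim !lfunE/= reindex_inl_vpair reindex_inr_vpair.
Qed.

Lemma direct_sum_affine X Y (K : set (vec R X)) (L : set (vec R Y))
    (U : {vspace vec R X}) (U' : {vspace vec R Y}) :
  affine_with_translate K U -> affine_with_translate L U' ->
  affine_with_translate (direct_sum K L) (vdirect_sum U U').
Proof.
move=> [x ->] [y ->]; exists (vpair x y); apply/seteqP; split=> z.
  move=> [_ [u uU <-] [_ [u' uU' <-] <-]]; exists (vpair u u').
    by rewrite /= vpair_vdirect_sum; apply/andP.
  by rewrite vpairD.
move=> [u]; rewrite /= -(vpair_eta u) vpair_vdirect_sum => /andP[uU uU'] <-.
exists (x + Defs.reindex inl u); first by exists (Defs.reindex inl u).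
exists (y + Defs.reindex inr u); first by exists (Defs.reindex inr u).
by rewrite vpairD.
Qed.

(** The translate hidden in [rigid] is determined by [K], so it may be taken to
    be any known one. *)
Lemma rigidE A B (U : {vspace vec R (A + B)}) (K : set (vec R B))
    (VB : {vspace vec R B}) :
  affine_with_translate K VB ->
  rigid ((U, K) : generalized_multiport R A B) <->
  (forall g : vec R B, exists f a b,
     [/\ vpair f a \in U, b \in VB & g = a + b]) /\
  (forall g : vec R B, vpair 0 g \in U -> g \in VB -> g = 0).
Proof.
move=> hK; split=> [[VB' [/= hK' full zero]]|[full zero]].
  rewrite -(affine_translate_uniq hK hK') in full zero.
  split=> [g|g gU gVB].
    have : g \in (restriction U + VB)%VS by rewrite full memvf.
    move=> /memv_addP[a /restrictionP[f faU] [b bVB ->]].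
    by exists f, a, b.
  apply/eqP; rewrite -memv0 -zero memv_cap gVB andbT.
  exact/contractionP.
exists VB; split=> //=.
  apply/eqP; rewrite eqEsubv subvf; apply/subvP => g _.
  have [f [a [b [faU bVB ->]]]] := full g.
  by apply: memv_add => //; apply/restrictionP; exists f.
apply/eqP; rewrite -subv0; apply/subvP => g.
by rewrite memv_cap memv0 => /andP[/contractionP gU /(zero _ gU) ->].
Qed.

End Rigidity.

Theorem theorem24 (R : realType) (W T V : finType)
    (V_WTV : {vspace vec R ((W + T) + V)})
    (A_T : set (vec R T)) (A_V : set (vec R V))
    (V_T : {vspace vec R T}) (V_V : {vspace vec R V})
    (hT : affine_with_translate A_T V_T)
    (hV : affine_with_translate A_V V_V) :
  rigid ((reassoc V_WTV, direct_sum A_T A_V) :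
           generalized_multiport R W (T + V)%type) <->
  rigid ((V_WTV, [set` V_V]) : generalized_multiport R (W + T)%type V) /\
  rigid ((matched_composition V_WTV V_V, [set` V_T]) :
           generalized_multiport R W T).
Proof.
have rN := rigidE (reassoc V_WTV) (direct_sum_affine hT hV).
have rN1 := rigidE V_WTV (affine_vspace V_V).
have rN2 := rigidE (matched_composition V_WTV V_V) (affine_vspace V_T).
split=> [/rN[full zero]|[/rN1[full1 zero1] /rN2[full2 zero2]]].
  split; [apply/rN1|apply/rN2]; split.
  - move=> v; have [w [a [b []]]] := full (vpair 0 v).
    rewrite -(vpair_eta a) -(vpair_eta b) vpair_vdirect_sum vpairD.
    move=> /reassocP aU /andP[_ bV] /vpair_inj[_ ->].
    exists (vpair w (Defs.reindex inl a)), (Defs.reindex inr a).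
    by exists (Defs.reindex inr b).
  - move=> v vU vV; have : vpair 0 v = 0 :> vec R (T + V).
      apply: zero; last by rewrite vpair_vdirect_sum mem0v.
      by apply/reassocP; rewrite vpair0.
    by rewrite -vpair0 => /vpair_inj[].
  - move=> t; have [w [a [b []]]] := full (vpair t 0).
    rewrite -(vpair_eta a) -(vpair_eta b) vpair_vdirect_sum vpairD.
    move=> /reassocP aU /andP[bT bV] /vpair_inj[-> ab0].
    exists w, (Defs.reindex inl a), (Defs.reindex inl b); split=> //.
    apply/matched_compositionP; exists (Defs.reindex inr a) => //.
    (* The V components of a and b are opposite, so that of a is in V_V as that of b is. *)
    by rewrite -rpredN (addr0_eq (esym ab0)).
  - move=> t /matched_compositionP[v vV tvU] tT.
    have : vpair t v = 0.
      apply: zero; last by rewrite vpair_vdirect_sum tT.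
      exact/reassocP.
    by rewrite -vpair0 => /vpair_inj[].
apply/rN; split=> [g|g]; rewrite -(vpair_eta g); set t := Defs.reindex inl g;
  set v := Defs.reindex inr g.
  have [wt1 [v1 [v2 [U1 v2V ->]]]] := full1 v.
  rewrite -(vpair_eta wt1) in U1.
  set t1 := Defs.reindex inr wt1 in U1.
  have [w3 [t3 [t4 [/matched_compositionP[v3 v3V U3] t4T tE]]]] :=
    full2 (t - t1).
  (* v3 is moved between the V parts of the two summands to fix the T part. *)
  exists (Defs.reindex inl wt1 + w3), (vpair (t1 + t3) (v1 + v3)),
    (vpair t4 (v2 - v3)); split.
  - by apply/reassocP; rewrite -!vpairD; apply: rpredD.
  - by rewrite vpair_vdirect_sum t4T rpredB.
  - rewrite vpairD -addrA -tE addrC subrK.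
    by rewrite [v2 - v3]addrC -addrA addNKr.
move=> /reassocP tvU; rewrite vpair_vdirect_sum => /andP[tT vV].
have t0 : t = 0.
  by apply: zero2 => //; apply/matched_compositionP; exists v.
move: tvU; rewrite t0 vpair0 => vU.
by rewrite (zero1 v vU vV) vpair0.
Qed.
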